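(* Let $S$ be an idempotent semifield, let $n\geq 1$, and let $$H_n(S)=\{A\in M_n(S): \text{there is a permutation } \sigma \text{ of } \{1,\dots,n\} \text{ such that } A_{i,\sigma(i)}\neq \mathbf{0} \text{ for all } i\}.$$ Let $U$ be the set of all idempotent matrices of $M_n(S)$ all of whose diagonal entries equal $\mathbf{1}$. Then the monoid $H_n(S)$ is $U$-Fountain. Moreover, each $\widetilde{\mathcal{R}}_U$-class and each $\widetilde{\mathcal{L}}_U$-class of $H_n(S)$ contains a unique idempotent of $U$: for $A\in H_n(S)$ the unique element of $U$ in the $\widetilde{\mathcal{R}}_U$-class of $A$ is $A^{(+)}$, and the unique element of $U$ in the $\widetilde{\mathcal{L}}_U$-class of $A$ is $((A^T)^{(+)})^T$.
   Context: An idempotent semifield is a commutative semiring $S$ with $x+x=x$ for all $x$, in which $S^*=S\setminus\{\mathbf{0}\}$ is an abelian group under multiplication with identity $\mathbf{1}$. The natural order is $a\leq b\iff a+b=b$; with it $S^*$ is a lattice ordered abelian group, $\mathbf{0}$ is the least element of $S$, and addition is least upper bound; $\bigwedge$ denotes greatest lower bound. $M_n(S)$ is the semigroup of $n\times n$ matrices under matrix multiplication. For $x\in S^n$, $\mathrm{Supp}(x)$ is the set of indices of non-zero entries of $x$, and $A_{i,\star}$ is the $i$th row of $A$. For $A\in M_n(S)$ the matrix $A^{(+)}\in M_n(S)$ is defined by $$(A^{(+)})_{i,j}=\begin{cases}\bigwedge\{A_{i,k}A_{j,k}^{-1}: k\in\mathrm{Supp}(A_{j,\star})\} & \text{if } \emptyset\neq\mathrm{Supp}(A_{j,\star})\subseteq\mathrm{Supp}(A_{i,\star}),\\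 \mathbf{0} & \text{otherwise.}\end{cases}$$ For a semigroup $T$ and a set $U$ of idempotents of $T$: $a\,\widetilde{\mathcal{R}}_U\,b$ iff for all $e\in U$, $ea=a\Leftrightarrow eb=b$; $a\,\widetilde{\mathcal{L}}_U\,b$ iff for all $e\in U$, $ae=a\Leftrightarrow be=b$. $T$ is $U$-Fountain if every $\widetilde{\mathcal{R}}_U$-class and every $\widetilde{\mathcal{L}}_U$-class of $T$ contains an idempotent of $U$. (Here $U\subseteq H_n(S)$, and $H_n(S)$ is a submonoid of $M_n(S)$.) *)

(* Defs.v *)
From HB Require Import structures.
From mathcomp Require Import all_boot all_order all_algebra all_fingroup.
From mathcomp Require Import boolp classical_sets.

Set Implicit Arguments.
Unset Strict Implicit.
Unset Printing Implicit Defensive.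

Import Order.TTheory GRing.Theory.

Local Open Scope ring_scope.

(* 1 != 0 comes from comNzSemiRingType; [sinv 0] is unspecified and unused. *)
HB.mixin Record isIdempotentSemifield S of GRing.ComNzSemiRing S := {
  saddxx : forall x : S, x + x = x;
  sinv : S -> S;
  smulVx : forall x : S, x != 0 -> sinv x * x = 1
}.

#[short(type="idemSemifieldType")]
HB.structure Definition IdempotentSemifield :=
  { S of isIdempotentSemifield S & GRing.ComNzSemiRing S }.

Arguments smulVx {s} [x].

(* The natural order lives on an alias of S, since a generic instance on S
   itself could clash with an order already carried by S. *)
Definition natord (S : Type) : Type := S.

Fact natord_display : Order.disp_t. Proof. exact: Order.Disp tt tt. Qed.

Section NaturalOrder.
Variable S : idemSemifieldType.

Definition natord_le (x y : S) : bool := x + y == y.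

Fact natord_le_refl : reflexive natord_le.
Proof. by move=> x; rewrite /natord_le saddxx. Qed.

Fact natord_le_anti : antisymmetric natord_le.
Proof. by move=> x y /andP[/eqP xy /eqP yx]; rewrite -yx addrC xy. Qed.

Fact natord_le_trans : transitive natord_le.
Proof.
by move=> y x z /eqP xy /eqP yz; rewrite /natord_le -yz addrA xy.
Qed.

HB.instance Definition _ := Choice.copy (natord S) S.
HB.instance Definition _ := Order.Le_isPOrder.Build natord_display (natord S)
  natord_le_refl natord_le_anti natord_le_trans.

End NaturalOrder.

Section IdempotentSemifieldTheory.
Variable S : idemSemifieldType.
Implicit Types x y z : S.

Lemma natord_leE (x y : natord S) : (x <= y)%O = natord_le x y.
Proof. by []. Qed.

Lemma natord_le0x x : natord_le 0 x.
Proof. by rewrite /natord_le add0r. Qed.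

Lemma natord_leUx x y z :
  natord_le (x + y) z = natord_le x z && natord_le y z.
Proof.
rewrite /natord_le; apply/eqP/andP => [<-|[/eqP xz /eqP yz]].
  by split; apply/eqP; [|rewrite (addrC x y)]; rewrite !addrA saddxx.
by rewrite -addrA yz xz.
Qed.

Lemma natord_le_mul x y z : natord_le y z -> natord_le (x * y) (x * z).
Proof. by rewrite /natord_le -mulrDr => /eqP->. Qed.

Lemma sadd_eq0 x y : (x + y == 0) = (x == 0) && (y == 0).
Proof.
apply/eqP/andP => [xy0|[/eqP-> /eqP->]]; last by rewrite addr0.
have: natord_le (x + y) 0 by rewrite xy0 /natord_le addr0.
by rewrite natord_leUx /natord_le !addr0 => /andP.
Qed.

Lemma smul_neq0 x y : x != 0 -> y != 0 -> x * y != 0.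
Proof.
move=> x0; apply: contra_neq => xy0.
by rewrite -[y]mul1r -(smulVx x0) -mulrA xy0 mulr0.
Qed.

Lemma sinv_neq0 x : x != 0 -> sinv x != 0.
Proof.
move=> x0; apply/eqP => i0; have := smulVx x0.
by rewrite i0 mul0r => /esym/eqP; rewrite oner_eq0.
Qed.

Lemma ssum_neq0 (I : finType) (P : pred I) (F : I -> S) i :
  P i -> F i != 0 -> \sum_(j | P j) F j != 0.
Proof. by move=> Pi Fi0; rewrite (bigD1 i) //= sadd_eq0 (negPf Fi0). Qed.

End IdempotentSemifieldTheory.

(* The greatest lower bound for the natural order. The default value 0 is
   irrelevant: [sglb] is only applied to nonempty finite sets of nonzero
   elements, which have a greatest lower bound by [infimums_fin_neq0] below. *)
Definition sglb (S : idemSemifieldType) (X : set S) : S :=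
  @infimum _ (natord S) (0 : S) X.

Section Plus.
Variables (S : idemSemifieldType) (n : nat).

Definition supp (x : 'rV[S]_n) : {set 'I_n} := [set i | x 0 i != 0]%SET.

Definition plusmx (A : 'M[S]_n) : 'M[S]_n :=
  \matrix_(i, j)
    if (supp (row j A) != finset.set0)
       && (supp (row j A) \subset supp (row i A))
    then sglb [set A i k * sinv (A j k) | k in [set` supp (row j A)]]%classic
    else 0.

End Plus.

Lemma infimums_fin_neq0 (S : idemSemifieldType) (I : finType) (D : {set I})
    (F : I -> S) : D != finset.set0 -> (forall k, k \in D -> F k != 0) ->
  @infimums _ (natord S) [set F k | k in [set` D]]%classic
    (sinv (\sum_(k in D) sinv (F k))).
Proof.
case/finset.set0Pn=> k0 Dk0 F0; set s := \sum_(k in D) _.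
have s0 : s != 0 by apply: (ssum_neq0 Dk0); apply: sinv_neq0; apply: F0.
split=> [_ [k /= Dk <-]|z lbz]; rewrite natord_leE.
  have : natord_le (sinv (F k)) s.
    by rewrite /natord_le /s (bigD1 k) //= addrA saddxx.
  move=> /(natord_le_mul (F k * sinv s)).
  by rewrite mulrAC (mulrC (F k)) smulVx ?F0// mul1r -mulrA smulVx// mulr1.
suff /(natord_le_mul (sinv s)) : natord_le (s * z) 1.
  by rewrite mulrA smulVx// mul1r mulr1.
rewrite /s mulr_suml.
elim/big_ind: _ => [|x y x1 y1|k Dk]; first exact: natord_le0x.
  by rewrite natord_leUx x1 y1.
rewrite -(smulVx (F0 _ Dk)); apply: natord_le_mul.
by apply: lbz; exists k.
Qed.

Section Hn.
Variables (S : idemSemifieldType) (n : nat).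

Definition inHn : pred 'M[S]_n :=
  fun A => [exists s : 'S_n, [forall i, A i (s i) != 0]].

Record Hn := MkHn { hmx :> 'M[S]_n; hmxP : inHn hmx }.

HB.instance Definition _ := [isSub for hmx].
HB.instance Definition _ := [Choice of Hn by <:].

Lemma inHn_mul (A B : Hn) : inHn (hmx A *m hmx B).
Proof.
case: A B => A /= /existsP[s /forallP sA] [B /= /existsP[t /forallP tB]].
apply/existsP; exists (s * t)%g; apply/forallP => i.
rewrite mxE permM; apply: (@ssum_neq0 _ _ _ _ (s i)) => //.
exact: smul_neq0.
Qed.

Lemma inHn1 : inHn 1%:M.
Proof.
apply/existsP; exists 1%g; apply/forallP => i.
by rewrite perm1 mxE eqxx oner_eq0.
Qed.

Definition Hn_mul (A B : Hn) : Hn := MkHn (inHn_mul A B).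
Definition Hn_one : Hn := MkHn inHn1.

Fact Hn_mulA : associative Hn_mul.
Proof. by move=> A B C; apply: val_inj; rewrite /= mulmxA. Qed.
Fact Hn_mul1 : left_id Hn_one Hn_mul.
Proof. by move=> A; apply: val_inj; rewrite /= mul1mx. Qed.
Fact Hn_mulr1 : right_id Hn_one Hn_mul.
Proof. by move=> A; apply: val_inj; rewrite /= mulmx1. Qed.

HB.instance Definition _ := isMonoid.Build Hn Hn_mulA Hn_mul1 Hn_mulr1.

Definition idem_diag1 : set 'M[S]_n :=
  [set E | E *m E = E /\ forall i, E i i = 1]%classic.

Lemma idem_diag1_Hn (E : 'M[S]_n) : idem_diag1 E -> inHn E.
Proof.
case=> _ E1; apply/existsP; exists 1%g; apply/forallP => i.
by rewrite perm1 E1 oner_eq0.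
Qed.

(* No element of [idem_diag1] is lost here, by [idem_diag1_Hn]. *)
Definition UHn : set Hn := [set E : Hn | idem_diag1 E]%classic.

End Hn.

Section Fountain.
Local Open Scope group_scope.
Variables (T : semigroupType) (U : set T).

Definition Rtilde (a b : T) := forall e, U e -> (e * a = a <-> e * b = b).

Definition Ltilde (a b : T) := forall e, U e -> (a * e = a <-> b * e = b).

Definition fountain :=
  [/\ forall e, U e -> e * e = e,
      forall a, exists2 e, U e & Rtilde a e &
      forall a, exists2 e, U e & Ltilde a e].

End Fountain.

(* Main.v *)
Require Import Defs.
From mathcomp Require Import all_boot all_order all_algebra all_fingroup.
From mathcomp Require Import boolp classical_sets.

(** Order matrices entrywise by the natural order of S. When no row of A is
    zero, [plusmx A] is the residual of A by itself: the inequality X A <= A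
    holds exactly when X <= [plusmx A] (lemma [mulmx_le_plusmx]).  Everything
    else is formal.

    For X in U the inequality X A >= A is automatic because X >= 1, so
    X A = A says the same as X <= [plusmx A].  Residuation also makes
    E := [plusmx A] a member of U: 1 A <= A gives E >= 1, and E E A <= E A <= A
    gives E E <= E (the reverse being clear from E >= 1), while a nonzero entry
    in row i of A can be cancelled from E A <= A to give E_ii <= 1.  Finally,
    for X and E both in U, X E = E is again equivalent to X <= E; hence E and A
    have the same left identities in U.  Such an E is unique: it is the greatest
    element of U fixing A on the left.

    Matrices with a nonzero diagonal along some permutation have no zero row, so
    this settles [Rtilde].  They are also stable under transposition, which
    preserves U and exchanges left and right multiplication, so the result for
    [Ltilde] follows. *)

Set Implicit Arguments.
Unset Strict Implicit.
Unset Printing Implicit Defensive.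

Import Order.TTheory GRing.Theory.

Local Open Scope ring_scope.

(** * Sums, quotients and meets in the natural order *)

Section NaturalOrderComplements.
Variable S : idemSemifieldType.
Implicit Types x y z : S.

Lemma natord_le_sumx (I : finType) (F : I -> S) y :
  natord_le (\sum_j F j) y <-> forall j, natord_le (F j) y.
Proof.
split=> [le_sum j|leF].
  by move: le_sum; rewrite (bigD1 j) //= natord_leUx; case/andP.
elim/big_ind: _ => [|a b le_a le_b|j _]; [exact: natord_le0x| |exact: leF].
by rewrite natord_leUx le_a le_b.
Qed.

Lemma natord_lex0 x : natord_le x 0 = (x == 0).
Proof. by rewrite /natord_le addr0. Qed.

Lemma natord_le_pdivr x y z :
  z != 0 -> natord_le x (y * sinv z) = natord_le (x * z) y.
Proof.
move=> z0; apply/idP/idP => /natord_le_mul le_xy.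
  by have := le_xy z; rewrite mulrCA (mulrC z (sinv z)) smulVx // mulr1 mulrC.
by have := le_xy (sinv z); rewrite mulrCA smulVx // mulr1 (mulrC _ y).
Qed.

Lemma natord_le_sglb (I : finType) (D : {set I}) (F : I -> S) x :
  D != finset.set0 -> (forall k, k \in D -> F k != 0) ->
  natord_le x (sglb [set F k | k in [set` D]]%classic)
    <-> forall k, k \in D -> natord_le x (F k).
Proof.
move=> D0 F0; rewrite /sglb.
set X := [set _ | _ in _]%classic.
have X0 : X != set0%classic.
  by have [k Dk] := finset.set0Pn _ D0; apply/set0P; exists (F k), k.
have [lb glb] : @infimums _ (natord S) X (@infimum _ (natord S) (0 : S) X).
  rewrite /infimum (negPf X0); apply: xgetPex.
  by exists (sinv (\sum_(k in D) sinv (F k))); apply: infimums_fin_neq0.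
split=> [le_x k Dk|le_x]; last by apply: glb => _ [k /= Dk <-]; apply: le_x.
by apply: (@le_trans _ (natord S) _ _ _ le_x); apply: lb; exists k.
Qed.

End NaturalOrderComplements.

(** * The entrywise order and left identities *)

Section MatrixOrder.
Variables (S : idemSemifieldType) (n : nat).
Implicit Types A B C E X : 'M[S]_n.

(** The entrywise natural order.  Written with matrix addition, monotonicity of
    the product is distributivity. *)
Definition mxle A B := A + B = B.

Lemma mxleP A B : mxle A B <-> forall i j, natord_le (A i j) (B i j).
Proof.
split=> [/matrixP le_AB i j|le_AB]; first by rewrite /natord_le -{2}le_AB mxE.
by apply/matrixP => i j; rewrite mxE; apply/eqP; apply: le_AB.
Qed.

Lemma mxle_refl A : mxle A A.
Proof. by apply/mxleP => i j; rewrite /natord_le saddxx. Qed.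

Lemma mxle_anti A B : mxle A B -> mxle B A -> A = B.
Proof. by rewrite /mxle => AB BA; rewrite -AB addrC BA. Qed.

Lemma mxle_trans B A C : mxle A B -> mxle B C -> mxle A C.
Proof. by rewrite /mxle => AB BC; rewrite -BC addrA AB. Qed.

Lemma mxle_mull X A B : mxle A B -> mxle (X *m A) (X *m B).
Proof. by rewrite /mxle -mulmxDr => ->. Qed.

Lemma mxle_mulr X A B : mxle A B -> mxle (A *m X) (B *m X).
Proof. by rewrite /mxle -mulmxDl => ->. Qed.

Lemma idem_diag1_ge1 E : idem_diag1 E -> mxle 1%:M E.
Proof.
case=> _ E1; apply/mxleP => i j; rewrite mxE.
by case: eqP => [->|_]; [rewrite E1 /natord_le saddxx|apply: natord_le0x].
Qed.

Lemma mulmx_fix_le X A : mxle 1%:M X -> X *m A = A <-> mxle (X *m A) A.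
Proof.
move=> X1; split=> [->|XA]; first exact: mxle_refl.
by apply: mxle_anti => //; rewrite -{1}[A]mul1mx; apply: mxle_mulr.
Qed.

(** If X E = E then X <= X E = E because 1 <= E; if X <= E then
    X E <= E E = E, and the reverse inequality holds because 1 <= X. *)
Lemma idem_diag1_fix_le X E :
  idem_diag1 X -> idem_diag1 E -> X *m E = E <-> mxle X E.
Proof.
move=> UX UE; have [EE _] := UE.
split=> [XE|XE].
  by rewrite -XE -{1}[X]mulmx1; apply/mxle_mull/idem_diag1_ge1.
by apply/(mulmx_fix_le _ (idem_diag1_ge1 UX)); rewrite -{2}EE; apply: mxle_mulr.
Qed.

Lemma tr_idem_diag1 E : idem_diag1 E -> idem_diag1 E^T.
Proof.
by case=> EE E1; split=> [|i]; [rewrite -trmx_mul EE|rewrite mxE E1].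
Qed.

End MatrixOrder.

(** * Residuation by a matrix without zero rows *)

Section Residual.
Variables (S : idemSemifieldType) (n : nat) (A : 'M[S]_n).
Hypothesis rowA : forall j, supp (row j A) != finset.set0.

Let in_supp j k : (k \in supp (row j A)) = (A j k != 0).
Proof. by rewrite inE mxE. Qed.

(** A nonzero x with x A_jk <= A_ik for all k forces the support of row j into
    that of row i, and then each condition with A_jk != 0 can be divided by
    A_jk; the conditions with A_jk = 0 are void.  When the supports are not
    nested only x = 0 remains, in agreement with the value 0 of [plusmx]. *)
Lemma natord_le_plusmx x i j :
  natord_le x (plusmx A i j) <-> forall k, natord_le (x * A j k) (A i k).
Proof.
rewrite mxE rowA /=; case: ifPn => [/fintype.subsetP sub|nsub].
  have A0 k : k \in supp (row j A) -> A i k * sinv (A j k) != 0.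
    move=> jk; apply: smul_neq0; first by rewrite -in_supp sub.
    by apply: sinv_neq0; rewrite -in_supp.
  rewrite (natord_le_sglb _ (rowA j) A0); split=> le_x k.
    have [->|jk] := eqVneq (A j k) 0; first by rewrite mulr0 natord_le0x.
    by rewrite -natord_le_pdivr //; apply: le_x; rewrite in_supp.
  by rewrite in_supp => jk; rewrite natord_le_pdivr.
rewrite natord_lex0; split=> [/eqP-> k|le_x].
  by rewrite mul0r natord_le0x.
apply: contraNT nsub => x0; apply/fintype.subsetP => k; rewrite !in_supp.
apply: contra_neq => ik; apply/eqP; have := le_x k.
by rewrite ik natord_lex0; apply: contraTT; apply: smul_neq0.
Qed.

Lemma mulmx_le_plusmx (X : 'M[S]_n) : mxle (X *m A) A <-> mxle X (plusmx A).
Proof.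
rewrite !mxleP; split=> le_X i j.
  apply/natord_le_plusmx => k; have := le_X i k.
  by rewrite mxE => /natord_le_sumx.
by rewrite mxE; apply/natord_le_sumx => k; move/natord_le_plusmx: (le_X i k).
Qed.

Lemma plusmx_mul_le : mxle (plusmx A *m A) A.
Proof. exact/mulmx_le_plusmx/mxle_refl. Qed.

Lemma plusmx_ge1 : mxle 1%:M (plusmx A).
Proof. by apply/mulmx_le_plusmx; rewrite mul1mx; apply: mxle_refl. Qed.

(** Residuation turns 1 A <= A into 1 <= E and E E A <= A into E E <= E, for
    E = [plusmx A]; the bound E_ii <= 1 comes from cancelling a nonzero A_ik in
    E_ii A_ik <= A_ik. *)
Lemma plusmx_idem_diag1 : idem_diag1 (plusmx A).
Proof.
split=> [|i].
  apply/(mulmx_fix_le _ plusmx_ge1)/mulmx_le_plusmx; rewrite -mulmxA.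
  exact: mxle_trans (mxle_mull _ plusmx_mul_le) plusmx_mul_le.
have [k] := finset.set0Pn _ (rowA i); rewrite in_supp => Aik.
apply: (@le_anti _ (natord S)); rewrite !natord_leE; apply/andP; split.
  have /natord_le_plusmx/(_ k) : natord_le (plusmx A i i) (plusmx A i i).
    by rewrite /natord_le saddxx.
  by rewrite -natord_le_pdivr // (mulrC (A i k)) smulVx.
by have /mxleP/(_ i i) := plusmx_ge1; rewrite mxE eqxx.
Qed.

Lemma idem_diag1_fix_plusmx (X : 'M[S]_n) :
  idem_diag1 X -> X *m A = A <-> X *m plusmx A = plusmx A.
Proof.
move=> UX; rewrite (mulmx_fix_le _ (idem_diag1_ge1 UX)) mulmx_le_plusmx.
by rewrite (idem_diag1_fix_le UX plusmx_idem_diag1).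
Qed.

End Residual.

(** * The Fountain property *)

Section Fountain.
Variables (S : idemSemifieldType) (n : nat).
Implicit Types A E F : Hn S n.

Lemma Hn_fixlE E A : (E * A)%g = A <-> hmx E *m hmx A = hmx A.
Proof. by split=> [{2}<-|EA]; [|apply: val_inj]. Qed.

Lemma Hn_fixrE A E : (A * E)%g = A <-> hmx A *m hmx E = hmx A.
Proof. by split=> [{2}<-|AE]; [|apply: val_inj]. Qed.

Lemma supp_row_Hn A j : supp (row j (hmx A)) != finset.set0.
Proof.
have /existsP[s /forallP As] := hmxP A.
by apply/finset.set0Pn; exists (s j); rewrite inE mxE.
Qed.

Lemma inHn_tr A : inHn (hmx A)^T.
Proof.
have /existsP[s /forallP As] := hmxP A.
apply/existsP; exists (s^-1)%g; apply/forallP => i; rewrite mxE.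
by have := As ((s^-1)%g i); rewrite permKV.
Qed.

Definition Hn_tr A : Hn S n := MkHn (inHn_tr A).

Lemma Hn_trK : involutive Hn_tr.
Proof. by move=> A; apply: val_inj; rewrite /= trmxK. Qed.

Lemma Hn_tr_U E : UHn E -> UHn (Hn_tr E).
Proof. exact: tr_idem_diag1. Qed.

Lemma Hn_trM A E : Hn_tr (A * E)%g = (Hn_tr E * Hn_tr A)%g.
Proof. by apply: val_inj; rewrite /= trmx_mul. Qed.

(** Transposition is an anti-automorphism of the monoid that preserves U. *)
Lemma Ltilde_tr A E :
  Ltilde (@UHn S n) A E <-> Rtilde (@UHn S n) (Hn_tr A) (Hn_tr E).
Proof.
have fix_tr B F : (Hn_tr F * Hn_tr B)%g = Hn_tr B <-> (B * F)%g = B.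
  by rewrite -Hn_trM; split=> [/(inv_inj Hn_trK)|->].
split=> AE F UF; last by rewrite -!fix_tr; apply/AE/Hn_tr_U.
by rewrite -[F]Hn_trK !fix_tr; apply/AE/Hn_tr_U.
Qed.

Definition Hn_plus A : Hn S n :=
  MkHn (idem_diag1_Hn (plusmx_idem_diag1 (supp_row_Hn A))).

Lemma Hn_plus_U A : UHn (Hn_plus A).
Proof. exact: plusmx_idem_diag1 (supp_row_Hn A). Qed.

Lemma Rtilde_plus A : Rtilde (@UHn S n) A (Hn_plus A).
Proof.
move=> F UF; rewrite !Hn_fixlE.
exact: idem_diag1_fix_plusmx (supp_row_Hn A) _ UF.
Qed.

(** Two elements of U in one class fix each other on the left, so each is below
    the other. *)
Lemma Rtilde_U_inj A E F : UHn E -> UHn F ->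
  Rtilde (@UHn S n) A E -> Rtilde (@UHn S n) A F -> E = F.
Proof.
have le B C : UHn B -> UHn C -> Rtilde (@UHn S n) A B ->
    Rtilde (@UHn S n) A C -> mxle (hmx B) (hmx C).
  move=> UB UC AB AC; apply/(idem_diag1_fix_le UB UC)/Hn_fixlE.
  by apply/(AC B UB)/(AB B UB)/Hn_fixlE; case: UB.
by move=> UE UF AE AF; apply/val_inj/mxle_anti; apply: le.
Qed.

Lemma unique_Rtilde A :
  unique (fun F => UHn F /\ Rtilde (@UHn S n) A F) (Hn_plus A).
Proof.
split=> [|F [UF AF]]; first by split; [apply: Hn_plus_U|apply: Rtilde_plus].
exact: Rtilde_U_inj (Hn_plus_U A) UF (Rtilde_plus A) AF.
Qed.

Lemma unique_Ltilde A :
  unique (fun F => UHn F /\ Ltilde (@UHn S n) A F) (Hn_tr (Hn_plus (Hn_tr A))).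
Proof.
have [[UE AE] uniqE] := unique_Rtilde (Hn_tr A).
split=> [|F [UF /Ltilde_tr AF]].
  by split; [apply: Hn_tr_U|apply/Ltilde_tr; rewrite Hn_trK].
by rewrite (uniqE (Hn_tr F)) ?Hn_trK //; split; first exact: Hn_tr_U.
Qed.

End Fountain.

Theorem corollary4p11 (S : idemSemifieldType) (n : nat) (hn : (1 <= n)%N) :
  fountain (@UHn S n)
  /\ (forall A : Hn S n, exists2 E : Hn S n,
        hmx E = plusmx (hmx A) &
        unique (fun F : Hn S n => UHn F /\ Rtilde (@UHn S n) A F) E)
  /\ (forall A : Hn S n, exists2 E : Hn S n,
        hmx E = trmx (plusmx (trmx (hmx A))) &
        unique (fun F : Hn S n => UHn F /\ Ltilde (@UHn S n) A F) E).
Proof.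
split; last split=> A.
- split=> [E [EE _]|A|A]; first exact/Hn_fixlE.
    by have [[UE AE] _] := unique_Rtilde A; exists (Hn_plus A).
  by have [[UE AE] _] := unique_Ltilde A; exists (Hn_tr (Hn_plus (Hn_tr A))).
- by exists (Hn_plus A); last exact: unique_Rtilde.
- by exists (Hn_tr (Hn_plus (Hn_tr A))); last exact: unique_Ltilde.
Qed.
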